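(* Let $n$ be a positive integer, let $Q\in \mathbb{R}^{n \times n}$ be an upper-triangular matrix, and let $G=(V,E)$ be a partial order of the $n$ binary variables $x_1,\dots,x_n$ that is valid with respect to minimization of the function $\phi: B_n\to\mathbb{R}$, $\phi(x) = x^\top Q x$. Let $Q^G\in\mathbb{R}^{n\times n}$ be the linearization of $Q$ with respect to $G$. Then $$\min_{x \in B_n} x^\top Q x = \min_{x \in B_n} x^\top Q^G x.$$ Moreover, if $x^* \in B_n$ attains the minimum of the right-hand side, then it attains the minimum of the left-hand side.
   Context: $B_n := \{0,1\}^n$. A partial order of $n$ binary variables $x=(x_1,\dots,x_n)$ is a directed acyclic graph $G=(V,E)$ with vertex set $V=\{x_1,\dots,x_n\}$ and edge set $E\subset V\times V$. Here, as vertices, $x_1,\dots,x_n$ are just symbols (equivalently, the indices $1,\dots,n$), while for a vector $x\in B_n$, $x_i\in\{0,1\}$ denotes its $i$-th entry. The subset of $B_n$ ordered by $G$ is $$B_n^G := \{ x\in B_n \mid \forall (x_i, x_j)\in E,\ x_i=1 \Rightarrow x_j=1 \}.$$ The partial order $G$ is valid with respect to minimization of $\phi: B_n\to\mathbb{R}$ if $\min\{\phi(x) \mid x \in B_n\} = \min\{\phi(x) \mid x \in B_n^G\}$. Linearization: for $i=1,\dots,n$ define $$U_i^+ := \{j \in \{1,\dots,n\} \mid (x_i,x_j) \in E,\ Q_{i,j} > 0\},\qquad U_i^- := \{j \in \{1,\dots,n\} \mid (x_i,x_j) \in E,\ Q_{j,i} > 0\}.$$ The linearization $Q^G$ of $Q$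 with respect to $G$ is the $n\times n$ matrix with entries $$Q^G_{i,j} := \begin{cases} 0 & \text{if } j \in U_i^+ \text{ or } i \in U_j^-,\\ Q_{i,i} + \sum_{j'\in U_i^+} Q_{i,j'} + \sum_{j'\in U_i^-} Q_{j',i} & \text{if } i=j,\\ Q_{i,j} & \text{otherwise.}\end{cases}$$ (Since $G$ is acyclic it has no loops, so the first two cases do not overlap.) *)

(* Defs.v *)
From mathcomp Require Import all_boot all_order all_algebra reals.

Set Implicit Arguments.
Unset Strict Implicit.
Unset Printing Implicit Defensive.

Import Order.TTheory GRing.Theory Num.Theory.
Local Open Scope ring_scope.

Notation binvec n := 'cV[bool]_n.

(* The value 0 on the empty set is junk; see minimumP. *)
Definition minimum (R : realType) (T : finType) (A : {set T}) (f : T -> R) : R :=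
  if [pick x in A] is Some x0 then f [arg min_(x < x0 in A) f x]%O else 0.

Lemma minimumP (R : realType) (T : finType) (A : {set T}) (f : T -> R) :
  A != set0 ->
  (exists2 x, x \in A & f x = minimum A f) /\
  (forall x, x \in A -> minimum A f <= f x).
Proof.
rewrite /minimum; case: pickP => [x0 Ax0 _|A0 /set0Pn[x]]; last by rewrite A0.
by case: arg_minP => // x Ax min_x; split; [exists x|].
Qed.

(* cycle E [::] holds trivially, and cycle E [:: i] means E i i, so loops are
   excluded. *)
Definition acyclic (n : nat) (E : rel 'I_n) : Prop :=
  forall c : seq 'I_n, cycle E c -> c = [::].

Definition ordered_subset (n : nat) (E : rel 'I_n) : {set binvec n} :=
  [set x : binvec n | [forall i, forall j, E i j ==> x i 0 ==> x j 0]].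

Lemma ordered_subset_neq0 (n : nat) (E : rel 'I_n) : ordered_subset E != set0.
Proof.
apply/set0Pn; exists (const_mx true); rewrite inE.
by apply/forallP => i; apply/forallP => j; rewrite !mxE !implybT.
Qed.

Definition valid_order (R : realType) (n : nat) (E : rel 'I_n)
    (phi : binvec n -> R) : Prop :=
  minimum [set: binvec n] phi = minimum (ordered_subset E) phi.

Definition quad_form (R : realType) (n : nat) (Q : 'M[R]_n) (x : binvec n) : R :=
  let v : 'cV[R]_n := map_mx (fun b : bool => b%:R) x in (v^T *m Q *m v) 0 0.

(* is_trig_mx is lower triangularity. *)
Definition upper_triangular (R : realType) (n : nat) (Q : 'M[R]_n) : bool :=
  is_trig_mx Q^T.

Definition Uplus (R : realType) (n : nat) (Q : 'M[R]_n) (E : rel 'I_n)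
    (i : 'I_n) : {set 'I_n} :=
  [set j | E i j && (0 < Q i j)].

Definition Uminus (R : realType) (n : nat) (Q : 'M[R]_n) (E : rel 'I_n)
    (i : 'I_n) : {set 'I_n} :=
  [set j | E i j && (0 < Q j i)].

Definition linearization (R : realType) (n : nat) (Q : 'M[R]_n)
    (E : rel 'I_n) : 'M[R]_n :=
  \matrix_(i, j)
    if (j \in Uplus Q E i) || (i \in Uminus Q E j) then 0
    else if i == j then
      Q i i + \sum_(k in Uplus Q E i) Q i k + \sum_(k in Uminus Q E i) Q k i
    else Q i j.

(* Main.v *)
Require Import Defs.
From mathcomp Require Import all_boot all_order all_algebra reals.
From mathcomp Require Import ring.

(* Linearizing replaces, for each edge (i, j) and each positive coefficient q
   of the product x_i x_j, the term q x_i x_j by q x_i.  This adds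
   q x_i (1 - x_j), which is nonnegative everywhere and vanishes on the vectors
   ordered by E.  So the linearized form dominates the original one, and agrees
   with it at an ordered minimizer, which exists by validity. *)

Set Implicit Arguments.
Unset Strict Implicit.
Unset Printing Implicit Defensive.

Import Order.TTheory GRing.Theory Num.Theory.
Local Open Scope ring_scope.

Lemma acyclic_irreflexive (n : nat) (E : rel 'I_n) (i : 'I_n) :
  acyclic E -> E i i = false.
Proof. by move=> acE; apply/negP => Eii; have := acE [:: i]; rewrite /= Eii => /(_ isT). Qed.

Lemma acyclic_asymmetric (n : nat) (E : rel 'I_n) (i j : 'I_n) :
  acyclic E -> E i j -> E j i = false.
Proof.
move=> acE Eij; apply/negP => Eji.
by have := acE [:: i; j]; rewrite /= Eij Eji => /(_ isT).
Qed.

Lemma quad_formE (R : realType) (n : nat) (Q : 'M[R]_n) (x : binvec n) :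
  quad_form Q x = \sum_i \sum_j Q i j * ((x i 0)%:R * (x j 0)%:R).
Proof.
rewrite /quad_form mxE exchange_big /=; apply: eq_bigr => j _.
rewrite !mxE mulr_suml; apply: eq_bigr => i _.
by rewrite !mxE; ring.
Qed.

(** The case distinction becomes a sum of corrections, so that the quadratic form can be expanded
    linearly. The two membership tests need the opposite edges [E i j] and [E j i]; acyclicity
    forbids having both, so no entry is subtracted twice, and it forbids loops, so no diagonal entry
    is erased. *)
Lemma linearizationE (R : realType) (n : nat) (Q : 'M[R]_n) (E : rel 'I_n)
    (i j : 'I_n) : acyclic E ->
  linearization Q E i j =
    Q i j - (if j \in Uplus Q E i then Q i j else 0)
    - (if i \in Uminus Q E j then Q i j else 0)
    + (if j == i then
         \sum_(k in Uplus Q E i) Q i k + \sum_(k in Uminus Q E i) Q k i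
       else 0).
Proof.
move=> acE; rewrite mxE !inE (eq_sym j).
have [<-|_] := eqVneq i j; first by rewrite acyclic_irreflexive //=; ring.
case Eij: (E i j); first rewrite (acyclic_asymmetric acE Eij).
  by case: ifP => /=; rewrite ?orbF => ->; ring.
by rewrite /=; case: ifP => _; ring.
Qed.

(** Each erased coefficient reappears on the diagonal at the tail [i] of its edge, where it
    multiplies [x i 0] instead of the product; the indicator is the difference of the two. *)
Lemma quad_form_linearization (R : realType) (n : nat) (Q : 'M[R]_n)
    (E : rel 'I_n) (x : binvec n) : acyclic E ->
  quad_form (linearization Q E) x =
    quad_form Q x
    + \sum_i (\sum_(j in Uplus Q E i) Q i j * (x i 0 && ~~ x j 0)%:R
              + \sum_(j in Uminus Q E i) Q j i * (x i 0 && ~~ x j 0)%:R).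
Proof.
move=> acE; rewrite !quad_formE.
pose b (i j : 'I_n) : R := (x i 0)%:R * (x j 0)%:R.
have slackE i j : (x i 0 && ~~ x j 0)%:R = (x i 0)%:R - b i j.
  by rewrite /b; case: (x i 0); case: (x j 0) => /=; ring.
have bC i j : b i j = b j i by rewrite /b mulrC.
have entryE i j : linearization Q E i j * b i j =
    Q i j * b i j - (if j \in Uplus Q E i then Q i j * b i j else 0)
    - (if i \in Uminus Q E j then Q i j * b i j else 0)
    + (if j == i then
         (\sum_(k in Uplus Q E i) Q i k + \sum_(k in Uminus Q E i) Q k i)
         * (x i 0)%:R
       else 0).
  rewrite linearizationE // mulrDl !mulrBl.
  congr (_ - _ - _ + _); try by case: ifP => //; rewrite mul0r.
  case: eqP => [->|_]; last by rewrite mul0r.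
  (* A binary variable equals its square, so diagonal entries act as linear coefficients. *)
  by congr (_ * _); rewrite /b -natrM mulnb andbb.
rewrite (eq_bigr _ (fun i _ => eq_bigr _ (fun j _ => entryE i j))).
under eq_bigr => i _.
  rewrite big_split !sumrB /= -!big_mkcond big_pred1_eq mulrDl !mulr_suml.
  over.
rewrite big_split !sumrB /=.
(* Entries erased through [Uminus] have the tail of the edge as column index; exchanging the sums
   groups them by tail, as on the diagonal. *)
have -> : \sum_i \sum_(j | i \in Uminus Q E j) Q i j * b i j =
          \sum_i \sum_(j in Uminus Q E i) Q j i * b i j.
  rewrite (exchange_big_dep xpredT) //=; apply: eq_bigr => i _.
  by apply: eq_bigr => j _; rewrite bC.
(* A general [c] covers both [Q i j] for [Uplus] and the transposed [Q j i] for [Uminus]. *)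
have sumE U (c : 'I_n -> 'I_n -> R) :
    \sum_i \sum_(j in U i) c i j * (x i 0 && ~~ x j 0)%:R =
    \sum_i \sum_(j in U i) c i j * (x i 0)%:R
    - \sum_i \sum_(j in U i) c i j * b i j.
  rewrite -sumrB; apply: eq_bigr => i _; rewrite -sumrB.
  by apply: eq_bigr => j _; rewrite slackE mulrBr.
by rewrite !big_split /= !sumE; ring.
Qed.

Lemma le_quad_form_linearization (R : realType) (n : nat) (Q : 'M[R]_n)
    (E : rel 'I_n) (x : binvec n) : acyclic E ->
  quad_form Q x <= quad_form (linearization Q E) x.
Proof.
move=> acE; rewrite quad_form_linearization // lerDl.
apply: sumr_ge0 => i _; apply: addr_ge0; apply: sumr_ge0 => j;
  by rewrite inE => /andP[_ /ltW Q_ge0]; rewrite mulr_ge0.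
Qed.

Lemma quad_form_linearization_ordered (R : realType) (n : nat) (Q : 'M[R]_n)
    (E : rel 'I_n) (x : binvec n) : acyclic E -> x \in ordered_subset E ->
  quad_form (linearization Q E) x = quad_form Q x.
Proof.
move=> acE; rewrite inE => /forallP ord_x.
have slack0 i j : E i j -> (x i 0 && ~~ x j 0) = false.
  by have /forallP/(_ j) := ord_x i => + Eij; rewrite Eij; do 2!case: (x _ 0).
rewrite quad_form_linearization // big1 ?addr0 // => i _.
by rewrite !big1 ?addr0 // => j; rewrite inE => /andP[/slack0-> _]; rewrite mulr0.
Qed.

Theorem theorem3 (R : realType) (n : nat) (n_gt0 : (0 < n)%N) (Q : 'M[R]_n)
    (Q_upper : upper_triangular Q) (E : rel 'I_n) (E_acyclic : acyclic E)
    (E_valid : valid_order E (quad_form Q)) :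
  minimum [set: binvec n] (quad_form Q) =
    minimum [set: binvec n] (quad_form (linearization Q E)) /\
  (forall x : binvec n,
     quad_form (linearization Q E) x =
       minimum [set: binvec n] (quad_form (linearization Q E)) ->
     quad_form Q x = minimum [set: binvec n] (quad_form Q)).
Proof.
have binvec_neq0 : [set: binvec n] != set0.
  by apply/set0Pn; exists (const_mx true).
have [_ minQ] := minimumP (quad_form Q) binvec_neq0.
have [[y _ yE] minL] := minimumP (quad_form (linearization Q E)) binvec_neq0.
have [[z z_ord zE] _] := minimumP (quad_form Q) (ordered_subset_neq0 E).
have le_QL x := le_quad_form_linearization Q x E_acyclic.
have min_eq : minimum [set: binvec n] (quad_form Q) =
    minimum [set: binvec n] (quad_form (linearization Q E)).
  (* One inequality is tested at the minimizer [y] of the linearized form, the other at the ordered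
     minimizer [z], where both forms agree. *)
  apply/le_anti/andP; split; first by rewrite -yE (le_trans (minQ y _)) ?inE.
  by rewrite E_valid -zE -(quad_form_linearization_ordered Q E_acyclic z_ord) minL.
(* At [x] the original form is squeezed between its own minimum and the equal minimum of the
   linearized form. *)
split=> // x xE; apply/le_anti; rewrite minQ ?inE // andbT.
by rewrite min_eq -xE le_QL.
Qed.
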